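(* Let $A$ be a regular ring containing a field of characteristic $p>0$, let $R=A[x_1,\ldots,x_m,y_1,\ldots,y_n]$ be standard bigraded over $A$, and let $M=\bigoplus_{(i,j)\in\mathbb{Z}^2}M_{(i,j)}$ be a bigraded $F_R$-finite $F_R$-module. If there is an integer $N$ such that $M_{(u,v)}=0$ for all $(u,v)\in\mathbb{Z}^2$ with $|u|\geq N$ and $|v|\geq N$ (both inequalities holding), then $M=0$.
   Context: Rings are commutative and Noetherian; $m,n\geq 1$. Standard bigraded means: elements of $A$ have bidegree $(0,0)$, each $x_i$ has bidegree $(1,0)$, each $y_j$ has bidegree $(0,1)$. For an $R$-module $M$, $F_R(M)={}^{1}R\otimes_R M$, where ${}^{1}R$ is $R$ with its usual left $R$-module structure and right structure $r'\cdot r=r^{p}r'$ (so $a\otimes rm=ar^p\otimes m$). If $M$ is bigraded, $F_R(M)$ is bigraded by $\operatorname{bideg}(r'\otimes m)=\operatorname{bideg}(r')+p\operatorname{bideg}(m)$. An $F_R$-module is an $R$-module $M$ with an $R$-isomorphism $\theta:M\to F_R(M)$; it is bigraded if $M$ is bigraded and $\theta$ preserves bidegree. A generating morphism of $M$ is an injective $R$-linear map $\beta:U\to F_R(U)$ such that $M=\varinjlim(U\xrightarrow{\beta}F_R(U)\xrightarrow{F_R(\beta)}F_R^2(U)\to\cdots)$ with $\theta$ induced by the maps $F_R^e(\beta)$. $M$ is $F_R$-finite if it has a generating morphism with $U$ a finitely generated $R$-module; it is a bigraded $F_R$-finite $F_R$-module if in addition $M$ (and $U$) are bigraded and $\beta$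 preserves bidegree. *)

(* Defs.v *)
From HB Require Import structures.
From mathcomp Require Import all_boot all_order all_algebra ring.
From mathcomp Require Import boolp.
From mathcomp Require Import freeg mpoly.

Set Implicit Arguments.
Unset Strict Implicit.
Unset Printing Implicit Defensive.

Import GRing.Theory.
Local Open Scope ring_scope.
Local Open Scope quotient_scope.

(* The localization of [A] at [P]; as [A] need not be a domain, the field of
   fractions of [fraction.v] cannot be used here. *)
Section Localization.
Variables (A : comNzRingType) (P : prime_idealr A).
Local Notation I := (P : {pred A}).

Definition preloc := {x : A * A | x.2 \notin I}.

Definition mkpreloc (a s : A) (sP : s \notin I) : preloc :=
  exist _ (a, s) sP.

Definition loc_equiv (x y : preloc) : bool :=
  `[< exists2 u : A, u \notin I &
        u * ((val x).1 * (val y).2) = u * ((val y).1 * (val x).2) >].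

Lemma notin_prime1 : 1 \notin I.
Proof. by rewrite idealr1. Qed.

Lemma notin_primeM s t : s \notin I -> t \notin I -> s * t \notin I.
Proof. by move=> sP tP; rewrite prime_idealrM negb_or sP. Qed.

Lemma loc_equiv_refl : reflexive loc_equiv.
Proof. by move=> x; apply/asboolP; exists 1; first exact: notin_prime1. Qed.

Lemma loc_equiv_sym : ssrbool.symmetric loc_equiv.
Proof. by move=> x y; apply/asboolP/asboolP => -[u uP e]; exists u. Qed.

Lemma loc_equiv_trans : transitive loc_equiv.
Proof.
move=> [[b t] /= tP] [[a s] /= sP] [[c r] /= rP].
move=> /asboolP[u uP /= e1] /asboolP[v vP /= e2]; apply/asboolP => /=.
exists (u * v * t); first by rewrite !notin_primeM.
have -> : u * v * t * (a * r) = v * r * (u * (a * t)) by ring.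
have -> : u * v * t * (c * s) = u * s * (v * (c * t)) by ring.
by rewrite e1 -e2; ring.
Qed.

Canonical loc_equiv_equiv :=
  EquivRel loc_equiv loc_equiv_refl loc_equiv_sym loc_equiv_trans.

Definition loc := {eq_quot loc_equiv}.
HB.instance Definition _ : EqQuotient _ loc_equiv loc := EqQuotient.on loc.
HB.instance Definition _ := Choice.on loc.

Lemma loc_eqP (x y : preloc) : (exists2 u : A, u \notin I &
    u * ((val x).1 * (val y).2) = u * ((val y).1 * (val x).2)) <->
  x = y %[mod loc].
Proof.
split=> [h|h]; first by apply/eqmodP/asboolP.
by apply/asboolP; have/eqmodP := h.
Qed.

Definition preloc0 : preloc := mkpreloc 0 notin_prime1.
Definition preloc1 : preloc := mkpreloc 1 notin_prime1.
Definition preloc_add (x y : preloc) : preloc :=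
  mkpreloc ((val x).1 * (val y).2 + (val y).1 * (val x).2)
           (notin_primeM (valP x) (valP y)).
Definition preloc_opp (x : preloc) : preloc := mkpreloc (- (val x).1) (valP x).
Definition preloc_mul (x y : preloc) : preloc :=
  mkpreloc ((val x).1 * (val y).1) (notin_primeM (valP x) (valP y)).

Definition loc0 : loc := \pi_loc preloc0.
Definition loc1 : loc := \pi_loc preloc1.
Definition loc_add (x y : loc) : loc := \pi_loc (preloc_add (repr x) (repr y)).
Definition loc_opp (x : loc) : loc := \pi_loc (preloc_opp (repr x)).
Definition loc_mul (x y : loc) : loc := \pi_loc (preloc_mul (repr x) (repr y)).

Lemma loc_addE x y : loc_add (\pi_loc x) (\pi_loc y) = \pi_loc (preloc_add x y).
Proof.
rewrite /loc_add; apply/loc_eqP => /=.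
have /loc_eqP[u uP] := reprK (\pi_loc x).
have /loc_eqP[v vP] := reprK (\pi_loc y).
move: (repr (\pi_loc x)) (repr (\pi_loc y)) => x' y'.
move: x y x' y' => [[a s] ?] [[b t] ?] [[a' s'] ?] [[b' t'] ?] /= ev eu.
exists (u * v); first exact: notin_primeM.
have -> : u * v * ((a' * t' + b' * s') * (s * t)) =
  v * t * t' * (u * (a' * s)) + u * s * s' * (v * (b' * t)) by ring.
by rewrite eu ev; ring.
Qed.

Lemma loc_oppE x : loc_opp (\pi_loc x) = \pi_loc (preloc_opp x).
Proof.
rewrite /loc_opp; apply/loc_eqP => /=.
have /loc_eqP[u uP e] := reprK (\pi_loc x).
by exists u => //; rewrite !mulNr !mulrN e.
Qed.

Lemma loc_mulE x y : loc_mul (\pi_loc x) (\pi_loc y) = \pi_loc (preloc_mul x y).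
Proof.
rewrite /loc_mul; apply/loc_eqP => /=.
have /loc_eqP[u uP] := reprK (\pi_loc x).
have /loc_eqP[v vP] := reprK (\pi_loc y).
move: (repr (\pi_loc x)) (repr (\pi_loc y)) => x' y'.
move: x y x' y' => [[a s] ?] [[b t] ?] [[a' s'] ?] [[b' t'] ?] /= ev eu.
exists (u * v); first exact: notin_primeM.
have -> : u * v * (a' * b' * (s * t)) = (u * (a' * s)) * (v * (b' * t)) by ring.
by rewrite eu ev; ring.
Qed.

Local Ltac loc_ring :=
  apply/loc_eqP; exists 1; [exact: notin_prime1 | rewrite /=; ring].

Lemma loc_addA : associative loc_add.
Proof.
elim/quotW=> x; elim/quotW=> y; elim/quotW=> z.
rewrite (loc_addE y z) (loc_addE x y) !loc_addE.
by loc_ring.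
Qed.

Lemma loc_addC : commutative loc_add.
Proof. by elim/quotW=> x; elim/quotW=> y; rewrite !loc_addE; loc_ring. Qed.

Lemma loc_add0 : left_id loc0 loc_add.
Proof. by elim/quotW=> x; rewrite !loc_addE; loc_ring. Qed.

Lemma loc_addN : left_inverse loc0 loc_opp loc_add.
Proof. by elim/quotW=> x; rewrite loc_oppE loc_addE; loc_ring. Qed.

HB.instance Definition _ :=
  GRing.isZmodule.Build loc loc_addA loc_addC loc_add0 loc_addN.

Lemma loc_mulA : associative loc_mul.
Proof.
elim/quotW=> x; elim/quotW=> y; elim/quotW=> z.
rewrite (loc_mulE y z) (loc_mulE x y) !loc_mulE.
by loc_ring.
Qed.

Lemma loc_mulC : commutative loc_mul.
Proof. by elim/quotW=> x; elim/quotW=> y; rewrite !loc_mulE; loc_ring. Qed.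

Lemma loc_mul1 : left_id loc1 loc_mul.
Proof. by elim/quotW=> x; rewrite !loc_mulE; loc_ring. Qed.

Lemma loc_mulD : left_distributive loc_mul loc_add.
Proof.
elim/quotW=> x; elim/quotW=> y; elim/quotW=> z.
by rewrite (loc_addE x y) !loc_mulE loc_addE; loc_ring.
Qed.

Lemma loc_oner_neq0 : loc1 != loc0.
Proof.
apply/eqP => /loc_eqP[u uP /=]; rewrite !mulr1 mulr0 => u0.
by rewrite u0 idealr0 in uP.
Qed.

HB.instance Definition _ := GRing.Zmodule_isComNzRing.Build loc
  loc_mulA loc_mulC loc_mul1 loc_mulD loc_oner_neq0.

End Localization.

Definition generated_by (S : nzRingType) (V : lmodType S) (s : seq V) (x : V)
    : Prop :=
  exists c : 'I_(size s) -> S, x = \sum_i c i *: s`_i.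

Definition finitely_generated (S : nzRingType) (V : lmodType S) : Prop :=
  exists s : seq V, forall x, generated_by s x.

(* Ideals of [S] are the submodules of the regular module [S^o]. They are
   boolean predicates, which is no restriction in classical logic. *)
Definition noetherian (S : comNzRingType) : Prop :=
  forall I : {pred S^o}, GRing.submod_closed I ->
    exists s : seq S^o, forall x, x \in I <-> generated_by s x.

(* An [idealr S] is a proper ideal. *)
Definition maximal_ideal (S : comNzRingType) (I : idealr S) : Prop :=
  forall J : idealr S,
    {subset (I : {pred S}) <= (J : {pred S})} ->
    {subset (J : {pred S}) <= (I : {pred S})}.

(* Strictly increasing chain [c 0 < ... < c e] of prime ideals; the values of
   [c] beyond [e] are irrelevant. *)
Definition prime_chain (S : comNzRingType) (e : nat) (c : nat -> prime_idealr S)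
    : Prop :=
  forall i, (i < e)%N ->
    {subset (c i : {pred S}) <= (c i.+1 : {pred S})} /\
    ~ {subset (c i.+1 : {pred S}) <= (c i : {pred S})}.

Definition krull_dim (S : comNzRingType) (d : nat) : Prop :=
  (exists c, @prime_chain S d c) /\
  (forall e c, @prime_chain S e c -> (e <= d)%N).

Definition regular_local (S : comNzRingType) : Prop :=
  noetherian S /\
  exists mx : idealr S,
    [/\ maximal_ideal mx,
        (forall J : idealr S, maximal_ideal J ->
           (J : {pred S}) =i (mx : {pred S})) &
        exists s : seq S^o, krull_dim S (size s) /\
          forall x, x \in (mx : {pred S}) <-> generated_by s x].

Definition regular (A : comNzRingType) : Prop :=
  noetherian A /\ forall P : prime_idealr A, regular_local (loc P).

Lemma freegU_scale (R : comNzRingType) (K : choiceType) (a r : R) (k : K) :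
  a *: << r *g k >> = << a * r *g k >> :> {freeg K / R}.
Proof. by apply/eqP/freeg_eqP => x; rewrite coeffZ !coeffU mulrA. Qed.

Lemma fglift_is_linear (R : comNzRingType) (K : choiceType) (N : lmodType R)
    (f : K -> N) : linear (fglift f : {freeg K / R} -> N).
Proof.
have fB := lift_is_additive f.
pose F := GRing.isZmodMorphism.Build _ _ (fglift f : {freeg K / R} -> N) fB.
pose fL : {additive {freeg K / R} -> N} := HB.pack (fglift f) F.
have sumE (s : seq (R * K)) :
    fglift f (\sum_(rk <- s) << rk.1 *g rk.2 >>) = \sum_(rk <- s) rk.1 *: f rk.2.
  by rewrite [LHS](raddf_sum fL); apply: eq_bigr => z _; rewrite /= liftU.
move=> a x y; rewrite [LHS](raddfD fL); congr (_ + _) => /=.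
have [s ->] : exists s : seq (R * K), x = \sum_(rk <- s) << rk.1 *g rk.2 >>.
  exists [seq (coeff z x, z) | z <- dom x].
  by rewrite big_map /= freeg_sumE.
rewrite sumE !scaler_sumr [LHS](raddf_sum fL) /=.
by apply: eq_bigr => z _; rewrite freegU_scale liftU scalerA.
Qed.

(* [frob p M] is the tensor product of [1R] and [M], presented as the left
   R-module generated by the symbols [1 (x) m], subject to additivity in [m]
   and to [1 (x) r m = r^p (x) m]; [frob_lift] below is its universal
   property. *)
Section Frobenius.
Variables (R : comNzRingType) (p : nat) (M : lmodType R).

Inductive frob_rel : {freeg M / R} -> Prop :=
| frob_rel0 : frob_rel 0
| frob_relL c z z' : frob_rel z -> frob_rel z' -> frob_rel (c *: z + z')
| frob_relD m m' : frob_rel (<< m + m' >> - << m >> - << m' >>)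
| frob_relZ r m : frob_rel (<< r *: m >> - << r ^+ p *g m >>).

Definition in_frob_rel (z : {freeg M / R}) : bool := `[< frob_rel z >].

Lemma in_frob_rel_zmod : zmod_closed in_frob_rel.
Proof.
split=> [|z z' /asboolP hz /asboolP hz']; apply/asboolP.
  exact: frob_rel0.
by rewrite addrC -scaleN1r; apply: frob_relL.
Qed.

Definition frob_relations : zmodClosed {freeg M / R} := HB.pack in_frob_rel
  (GRing.isZmodClosed.Build {freeg M / R} in_frob_rel in_frob_rel_zmod).

Definition frob : Type := {ideal_quot frob_relations}.
HB.instance Definition _ := GRing.Zmodule.on frob.

Definition frob_pi (z : {freeg M / R}) : frob := \pi_({ideal_quot frob_relations}) z.
Definition frob_repr (x : frob) : {freeg M / R} :=
  repr (x : {ideal_quot frob_relations}).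

Lemma frob_reprK x : frob_pi (frob_repr x) = x.
Proof. exact: reprK. Qed.

Lemma frob_piP z z' : frob_pi z = frob_pi z' <-> frob_rel (z - z').
Proof.
have e : `[< frob_rel (z - z') >] = (frob_pi z == frob_pi z').
  exact: (Quotient.idealrBE frob_relations z z').
by split=> [/eqP|h]; [rewrite -e => /asboolP | apply/eqP; rewrite -e; apply/asboolP].
Qed.

Lemma frob_piD z z' : frob_pi (z + z') = frob_pi z + frob_pi z'.
Proof. exact: (raddfD (\pi_({ideal_quot frob_relations}))). Qed.

Lemma frob_pi0 : frob_pi 0 = 0.
Proof. exact: (raddf0 (\pi_({ideal_quot frob_relations}))). Qed.

Definition frob_scale (c : R) (x : frob) : frob := frob_pi (c *: frob_repr x).

Lemma frob_scaleE c z : frob_scale c (frob_pi z) = frob_pi (c *: z).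
Proof.
apply/frob_piP; rewrite -scalerBr -[_ *: _]addr0.
by apply: frob_relL frob_rel0; apply/frob_piP; rewrite frob_reprK.
Qed.

Lemma frob_scaleA a b x : frob_scale a (frob_scale b x) = frob_scale (a * b) x.
Proof. by rewrite -(frob_reprK x) !frob_scaleE scalerA. Qed.

Lemma frob_scale1 : left_id 1 frob_scale.
Proof. by move=> x; rewrite -(frob_reprK x) frob_scaleE scale1r. Qed.

Lemma frob_scaleDr : right_distributive frob_scale +%R.
Proof.
move=> c x y; rewrite -(frob_reprK x) -(frob_reprK y) -frob_piD !frob_scaleE.
by rewrite scalerDr frob_piD.
Qed.

Lemma frob_scaleDl x : {morph frob_scale^~ x : a b / a + b}.
Proof.
by move=> a b; rewrite -(frob_reprK x) !frob_scaleE scalerDl frob_piD.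
Qed.

HB.instance Definition _ := GRing.Zmodule_isLmodule.Build R frob
  frob_scaleA frob_scale1 frob_scaleDr frob_scaleDl.

Lemma frob_piZ c z : frob_pi (c *: z) = c *: frob_pi z.
Proof. by rewrite -frob_scaleE. Qed.

(* [tens r m] is [r (x) m]. *)
Definition tens (r : R) (m : M) : frob := frob_pi << r *g m >>.

Lemma scale_tens a r m : a *: tens r m = tens (a * r) m.
Proof. by rewrite /tens -freegU_scale frob_piZ. Qed.

Lemma tensDl r r' m : tens (r + r') m = tens r m + tens r' m.
Proof. by rewrite /tens -freegUD frob_piD. Qed.

Lemma tensDr r m m' : tens r (m + m') = tens r m + tens r m'.
Proof.
rewrite -[r]mulr1 -!scale_tens -scalerDr; congr (_ *: _).
rewrite -frob_piD; apply/frob_piP.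
by rewrite opprD addrA; apply: frob_relD.
Qed.

Lemma tensZr a r m : tens a (r *: m) = tens (a * r ^+ p) m.
Proof.
rewrite -[in LHS](mulr1 a) -!scale_tens; congr (_ *: _).
by apply/frob_piP; apply: frob_relZ.
Qed.

Lemma frob_sumE (x : frob) :
  exists s : seq (R * M), x = \sum_(rm <- s) tens rm.1 rm.2.
Proof.
exists [seq (coeff z (frob_repr x), z) | z <- dom (frob_repr x)].
rewrite big_map /= -[in LHS](frob_reprK x) -[in LHS](freeg_sumE (frob_repr x)).
by rewrite (big_morph frob_pi frob_piD frob_pi0).
Qed.

Definition frob_lift (N : lmodType R) (g : M -> N) (x : frob) : N :=
  fglift g (frob_repr x).

Section Lift.
Variables (N : lmodType R) (g : M -> N).
Hypothesis gD : {morph g : m m' / m + m'}.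
Hypothesis gZ : forall r m, g (r *: m) = r ^+ p *: g m.

Lemma frob_lift_pi z : frob_lift g (frob_pi z) = fglift g z.
Proof.
have lin := fglift_is_linear g.
pose F := GRing.isLinear.Build _ _ _ _ (fglift g : {freeg M / R} -> N) lin.
pose gL : {linear {freeg M / R} -> N} := HB.pack (fglift g) F.
apply/eqP; rewrite -subr_eq0 -[_ - _]/(gL _ - gL _) -raddfB; apply/eqP.
have /frob_piP : frob_pi (frob_repr (frob_pi z)) = frob_pi z.
  exact: frob_reprK.
elim=> [|c y y' _ hy _ hy'|m m'|r m].
- exact: raddf0.
- by rewrite [LHS]lin [fglift _ _]hy [fglift _ _]hy' scaler0 addr0.
- by rewrite !(raddfB gL) /= !liftU !scale1r gD -addrA -opprD subrr.
- by rewrite (raddfB gL) /= !liftU scale1r gZ subrr.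
Qed.

Lemma frob_lift_is_linear : linear (frob_lift g).
Proof.
move=> c x y; rewrite -(frob_reprK x) -(frob_reprK y) -frob_piZ -frob_piD.
by rewrite !frob_lift_pi fglift_is_linear.
Qed.

Lemma frob_lift_tens r m : frob_lift g (tens r m) = r *: g m.
Proof. by rewrite frob_lift_pi liftU. Qed.

Lemma frob_lift_uniq (h : {linear frob -> N}) :
  (forall m, h (tens 1 m) = g m) -> h =1 frob_lift g.
Proof.
move=> hE x; have [s ->] := frob_sumE x.
pose F := GRing.isLinear.Build _ _ _ _ (frob_lift g) frob_lift_is_linear.
pose gL : {linear frob -> N} := HB.pack (frob_lift g) F.
rewrite -[RHS]/(gL _) !raddf_sum; apply: eq_bigr => -[r m] _ /=.
by rewrite frob_lift_tens -[r]mulr1 -scale_tens linearZ /= hE mulr1.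
Qed.

End Lift.
End Frobenius.

Section FrobeniusMap.
Variables (R : comNzRingType) (p : nat) (M N : lmodType R).
Variable f : {linear M -> N}.

Definition frob_map : frob p M -> frob p N :=
  frob_lift (fun m => tens p 1 (f m)).

Lemma frob_map_morphD : {morph (fun m => tens p 1 (f m)) : m m' / m + m'}.
Proof. by move=> m m'; rewrite linearD tensDr. Qed.

Lemma frob_map_morphZ r m :
  tens p 1 (f (r *: m)) = r ^+ p *: tens p 1 (f m).
Proof. by rewrite linearZ tensZr scale_tens mul1r mulr1. Qed.

HB.instance Definition _ := GRing.isLinear.Build R _ _ _ frob_map
  (frob_lift_is_linear frob_map_morphD frob_map_morphZ).

Lemma frob_map_tens r m : frob_map (tens p r m) = tens p r (f m).
Proof.
by rewrite /frob_map (frob_lift_tens frob_map_morphD frob_map_morphZ)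
           scale_tens mulr1.
Qed.

End FrobeniusMap.

Arguments frob_map {R} p {M N} f.

Fixpoint frob_iter (R : comNzRingType) (p e : nat) (U : lmodType R)
    : lmodType R :=
  if e is e'.+1 then frob p (frob_iter p e' U) else U.

(* [frob_iter_map b e] is [F^e(b)]. *)
Fixpoint frob_iter_map (R : comNzRingType) (p : nat) (U : lmodType R)
    (b : {linear U -> frob p U}) (e : nat)
    : {linear frob_iter p e U -> frob_iter p e.+1 U} :=
  if e is e'.+1 return {linear frob_iter p e U -> frob_iter p e.+1 U}
  then frob_map p (frob_iter_map b e') else b.

Definition direct_limit (R : comNzRingType) (T : nat -> lmodType R)
    (t : forall e, {linear T e -> T e.+1}) (L : lmodType R)
    (psi : forall e, {linear T e -> L}) : Prop :=
  (forall e x, psi e.+1 (t e x) = psi e x) /\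
  forall (N : lmodType R) (g : forall e, {linear T e -> N}),
    (forall e x, g e.+1 (t e x) = g e x) ->
    exists h : {linear L -> N},
      (forall e x, h (psi e x) = g e x) /\
      forall h' : {linear L -> N},
        (forall e x, h' (psi e x) = g e x) -> h' =1 h.

(* The last clause says that [theta] is the map induced on the limits by the
   maps [F^e(b)] from the system [F^e(U)] to the system [F^(e+1)(U)], the
   latter having limit [F(M)] through the maps [F(psi e)]. *)
Definition generating_morphism (R : comNzRingType) (p : nat)
    (M : lmodType R) (theta : {linear M -> frob p M})
    (U : lmodType R) (b : {linear U -> frob p U}) : Prop :=
  injective b /\
  exists psi : forall e, {linear frob_iter p e U -> M},
    direct_limit (frob_iter_map b) psi /\
    forall e x, theta (psi e x) = frob_map p (psi e) (frob_iter_map b e x).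

(* [G d x] means that [x] lies in the component of bidegree [d]. *)
Definition bigrading (V : Type) := int * int -> V -> Prop.

(* The variables [x_1 .. x_m] of [{mpoly A[m + n]}] are the first [m] ones,
   and [y_1 .. y_n] are the last [n] ones. *)
Definition bideg_monom (m n : nat) (mu : 'X_{1..m + n}) : int * int :=
  (Posz (\sum_(i < m) mu (lshift n i))%N, Posz (\sum_(j < n) mu (rshift m j))%N).

Definition poly_bigrading (A : comNzRingType) (m n : nat)
    : bigrading {mpoly A[m + n]} :=
  fun d f => forall mu, mu \in msupp f -> bideg_monom mu = d.

Record is_bigraded (A : comNzRingType) (m n : nat)
    (M : lmodType {mpoly A[m + n]}) (G : bigrading M) : Prop := IsBigraded {
  bigraded0 : forall d, G d 0;
  bigradedB : forall d x y, G d x -> G d y -> G d (x - y);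
  bigradedZ : forall d e f x,
    poly_bigrading d f -> G e x -> G (d + e) (f *: x);
  bigraded_span : forall x, exists s : seq (int * int),
    exists2 c : int * int -> M,
      forall d, G d (c d) & x = \sum_(d <- s) c d;
  bigraded_free : forall (s : seq (int * int)) (c : int * int -> M),
    uniq s -> (forall d, G d (c d)) -> \sum_(d <- s) c d = 0 ->
    forall d, d \in s -> c d = 0
}.

(* The component of bidegree [d] is the additive span of the [r (x) x] with
   [r] and [x] homogeneous and [bideg r + p bideg x = d]. *)
Inductive frob_bigrading (A : comNzRingType) (m n p : nat)
    (M : lmodType {mpoly A[m + n]}) (G : bigrading M)
    : bigrading (frob p M) :=
| frob_bigrading0 d : frob_bigrading G d 0
| frob_bigradingD d x y :
    frob_bigrading G d x -> frob_bigrading G d y -> frob_bigrading G d (x + y)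
| frob_bigrading_tens d e r x :
    poly_bigrading d r -> G e x ->
    frob_bigrading G (d + e *+ p) (tens p r x).

Definition preserves_bidegree (V W : Type) (G : bigrading V) (H : bigrading W)
    (f : V -> W) : Prop :=
  forall d x, G d x -> H d (f x).

Record bigraded_F_module (A : comNzRingType) (m n p : nat)
    (M : lmodType {mpoly A[m + n]}) (G : bigrading M)
    (theta : {linear M -> frob p M}) : Prop := BigradedFModule {
  F_module_bigraded : is_bigraded G;
  F_module_bijective : bijective theta;
  F_module_bidegree : preserves_bidegree G (frob_bigrading (p := p) G) theta
}.

Record bigraded_F_finite (A : comNzRingType) (m n p : nat)
    (M : lmodType {mpoly A[m + n]}) (G : bigrading M)
    (theta : {linear M -> frob p M}) : Prop := BigradedFFinite {
  F_finite_F_module : bigraded_F_module G theta;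
  F_finite_generated :
    exists (U : lmodType {mpoly A[m + n]}) (H : bigrading U)
           (b : {linear U -> frob p U}),
      [/\ finitely_generated U, is_bigraded H,
          preserves_bidegree H (frob_bigrading (p := p) H) b &
          generating_morphism theta b]
}.

(* Main.v *)
(* Write [Phi z] for the element of [M] with [theta (Phi z) = 1 (x) z]; it is
   [p]-linear and multiplies bidegrees by [p]. As [R] is free over its
   subring A[x^q, y^q], q = p^e, on the monomials with exponents below [q], no
   monomial of degree less than [q] kills a nonzero [Phi^e v]; this is seen by
   letting Hasse derivatives act on [M]. If [v] is homogeneous of bidegree
   (a, b), then x_1^s y_1^t [Phi^e v] has bidegree (q a + s, q b + t), which lies
   in the region where [M] vanishes for a large [e] and suitable s, t < q / 2.
   Hence every element of [M] is killed by some [Phi^e]. Since [M] is the union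
   of the submodules generated by the [Phi^e v_i] for finitely many [v_i], it
   is zero. *)
From HB Require Import structures.
Require Import Defs.
From mathcomp Require Import all_boot all_order all_algebra.
From mathcomp Require Import boolp functions.
From mathcomp Require Import freeg mpoly.

Import Order.TTheory GRing.Theory Num.Theory.
Local Open Scope ring_scope.

Set Implicit Arguments.
Unset Strict Implicit.
Unset Printing Implicit Defensive.

(** * Modules with a twisted scalar action *)

Definition restr_scalars (R S : nzRingType) (phi : {rmorphism R -> S})
  (N : lmodType S) : Type := N.

Section RestrictionOfScalars.
Variables (R S : nzRingType) (phi : {rmorphism R -> S}) (N : lmodType S).

Local Notation restr := (restr_scalars phi N).
HB.instance Definition _ := GRing.Zmodule.on restr.

Definition restr_scale (r : R) (x : restr) : restr := phi r *: (x : N).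

Lemma restr_scaleA a b x :
  restr_scale a (restr_scale b x) = restr_scale (a * b) x.
Proof. by rewrite /restr_scale scalerA rmorphM. Qed.

Lemma restr_scale1 : left_id 1 restr_scale.
Proof. by move=> x; rewrite /restr_scale rmorph1 scale1r. Qed.

Lemma restr_scaleDr : right_distributive restr_scale +%R.
Proof. by move=> c x y; rewrite /restr_scale scalerDr. Qed.

Lemma restr_scaleDl x : {morph restr_scale^~ x : a b / a + b}.
Proof. by move=> a b; rewrite /restr_scale rmorphD scalerDl. Qed.

HB.instance Definition _ := GRing.Zmodule_isLmodule.Build R restr
  restr_scaleA restr_scale1 restr_scaleDr restr_scaleDl.

End RestrictionOfScalars.

(* The indeterminate acts on functions [J -> M] as precomposition by [s]. *)
Definition shift_mod (R : comNzRingType) (M : lmodType R) (J : Type)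
  (s : J -> J) : Type := J -> M.

Section ShiftModule.
Variables (R : comNzRingType) (M : lmodType R) (J : Type) (s : J -> J).

Local Notation shift_mod := (shift_mod M s).
HB.instance Definition _ := GRing.Zmodule.on shift_mod.

Definition shift_scale (P : {poly R}) (f : shift_mod) : shift_mod :=
  fun j => \sum_(k < size P) P`_k *: f (iter k s j).

Lemma shift_scale_bound d (P : {poly R}) (f : shift_mod) j :
  (size P <= d)%N -> shift_scale P f j = \sum_(k < d) P`_k *: f (iter k s j).
Proof.
move=> le; rewrite /shift_scale (big_ord_widen d (fun k => P`_k *: f (iter k s j)) le).
rewrite big_mkcond; apply: eq_bigr => k _; case: ltnP => // h.
by rewrite nth_default // scale0r.
Qed.

Lemma shift_scaleDl f : {morph shift_scale^~ f : P Q / P + Q}.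
Proof.
move=> P Q; apply: funext => j.
pose d := maxn (size P) (size Q).
have hP : (size P <= d)%N by rewrite leq_maxl.
have hQ : (size Q <= d)%N by rewrite leq_maxr.
have hPQ : (size (P + Q)%R <= d)%N by rewrite size_polyD.
transitivity (shift_scale P f j + shift_scale Q f j : M) => [|//].
rewrite !(@shift_scale_bound d) // -big_split /=.
by apply: eq_bigr => k _; rewrite coefD scalerDl.
Qed.

Lemma shift_scaleDr : right_distributive shift_scale +%R.
Proof.
move=> P f g; apply: funext => j.
transitivity (shift_scale P f j + shift_scale P g j : M) => [|//].
rewrite -big_split.
by apply: eq_bigr => k _; rewrite [LHS]scalerDr.
Qed.

Lemma shift_scaleC c f : shift_scale c%:P f = fun j => c *: f j.
Proof.
apply: funext => j; rewrite (shift_scale_bound f j (size_polyC_leq1 c)).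
by rewrite big_ord1 coefC.
Qed.

Lemma shift_scaleMX P f :
  shift_scale (P * 'X) f = shift_scale P (fun j => f (s j)).
Proof.
apply: funext => j.
have h : (size (P * 'X)%R <= (size P).+1)%N.
  by rewrite (leq_trans (size_polyMleq _ _)) // size_polyX addn2.
rewrite (shift_scale_bound f j h) big_ord_recl coefMX scale0r add0r.
by apply: eq_bigr => k _; rewrite coefMX.
Qed.

Lemma shift_scaleCM c Q f :
  shift_scale (c%:P * Q) f = fun j => c *: shift_scale Q f j.
Proof.
apply: funext => j.
have h : (size (c%:P * Q)%R <= size Q)%N by rewrite mul_polyC size_scale_leq.
rewrite (shift_scale_bound f j h) scaler_sumr; apply: eq_bigr => k _.
by rewrite coefCM scalerA.
Qed.

Lemma shift_scaleXM Q f :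
  shift_scale ('X * Q) f = fun j => shift_scale Q f (s j).
Proof.
rewrite mulrC shift_scaleMX; apply: funext => j.
by apply: eq_bigr => k _; rewrite -iterSr.
Qed.

Lemma shift_scaleCXn c d f j :
  shift_scale (c%:P * 'X^d) f j = c *: f (iter d s j).
Proof.
rewrite shift_scaleCM; congr (_ *: _).
elim: d j => [|d IH] j; last by rewrite exprS shift_scaleXM IH iterSr.
by rewrite expr0 -polyC1 shift_scaleC scale1r.
Qed.

Lemma shift_scaleA P Q f :
  shift_scale P (shift_scale Q f) = shift_scale (P * Q) f.
Proof.
elim/poly_ind: P Q f => [|P c IH] Q f.
  by apply: funext => j; rewrite mul0r /shift_scale size_poly0 !big_ord0.
rewrite mulrDl !shift_scaleDl shift_scaleC shift_scaleCM; congr (_ + _).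
by rewrite shift_scaleMX -mulrA -IH shift_scaleXM.
Qed.

Lemma shift_scale1 : left_id 1 shift_scale.
Proof.
by move=> f; rewrite shift_scaleC; apply: funext => j; rewrite scale1r.
Qed.

HB.instance Definition _ := GRing.Zmodule_isLmodule.Build {poly R} shift_mod
  shift_scaleA shift_scale1 shift_scaleDr shift_scaleDl.

End ShiftModule.

(** * The [p]-linear map carried by an F-module *)

Section PLinearStructure.
Variables (R : comNzRingType) (p : nat) (M : lmodType R).
Variables (theta : {linear M -> frob p M}) (theta_inv : frob p M -> M).
Hypotheses (thetaK : cancel theta theta_inv) (theta_invK : cancel theta_inv theta).

Definition frob_act (z : M) : M := theta_inv (tens p 1 z).
Local Notation Phi := frob_act.

Lemma theta_frob_act z : theta (Phi z) = tens p 1 z.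
Proof. exact: theta_invK. Qed.

Lemma theta_frob_actZ r z : theta (r *: Phi z) = tens p r z.
Proof. by rewrite linearZ /= theta_frob_act scale_tens mulr1. Qed.

Lemma frob_actD : {morph Phi : z z' / z + z'}.
Proof.
move=> z z'; apply: (can_inj thetaK).
by rewrite linearD /= !theta_frob_act tensDr.
Qed.

Lemma frob_actZ r z : Phi (r *: z) = r ^+ p *: Phi z.
Proof.
apply: (can_inj thetaK).
by rewrite theta_frob_act theta_frob_actZ tensZr mul1r.
Qed.

Lemma frob_act0 : Phi 0 = 0.
Proof. by apply: (addrI (Phi 0)); rewrite -frob_actD !addr0. Qed.

Lemma iter_frob_actD e : {morph iter e Phi : z z' / z + z'}.
Proof. by elim: e => // e IH z z'; rewrite !iterS IH frob_actD. Qed.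

Lemma iter_frob_actZ e r z : iter e Phi (r *: z) = r ^+ (p ^ e) *: iter e Phi z.
Proof.
elim: e => [|e IH]; first by rewrite expn0 expr1.
by rewrite !iterS IH frob_actZ -exprM expnSr.
Qed.

Lemma iter_frob_act0 e : iter e Phi 0 = 0.
Proof. by elim: e => // e IH; rewrite iterS IH frob_act0. Qed.

Lemma iter_frob_act_sum e (I : Type) (l : seq I) (F : I -> M) :
  iter e Phi (\sum_(i <- l) F i) = \sum_(i <- l) iter e Phi (F i).
Proof. exact: (big_morph _ (@iter_frob_actD e) (iter_frob_act0 e)). Qed.

Lemma iter_frob_act_eq0 e e' z :
  (e <= e')%N -> iter e Phi z = 0 -> iter e' Phi z = 0.
Proof.
by move=> le e0; rewrite -(subnK le) iterD e0 iter_frob_act0.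
Qed.

(* [theta] iterated makes [M] its own [e]-fold Frobenius pullback; this is the
   universal property of that pullback. The induction step views [N] as a module
   through the Frobenius of [R]. *)
Lemma frob_act_lift (pR : p \in [pchar R]) (e : nat) (N : lmodType R) (g : M -> N) :
  {morph g : z z' / z + z'} -> (forall r z, g (r *: z) = r ^+ (p ^ e) *: g z) ->
  exists h : {linear M -> N}, forall z, h (iter e Phi z) = g z.
Proof.
elim: e N g => [|e IH] N g gD gZ.
  have gL : linear g by move=> a x y; rewrite gD gZ expn0 expr1.
  pose F := GRing.isLinear.Build _ _ _ _ g gL.
  by exists (HB.pack g F : {linear M -> N}).
have [h hE] := IH (restr_scalars (pFrobenius_aut pR) N) g gD (fun r z =>
  etrans (gZ r z) (congr1 (fun c => c *: (g z : N))
    (etrans (congr1 _ (expnSr p e)) (exprM r _ _)))).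
have hD : {morph (h : M -> N) : m m' / m + m'} by move=> x y; exact: raddfD.
have hZ r m : (h (r *: m) : N) = r ^+ p *: (h m : N).
  by rewrite linearZ.
have lin : linear (frob_lift (h : M -> N) \o theta).
  by move=> c x y /=; rewrite linearP (frob_lift_is_linear hD hZ).
pose F := GRing.isLinear.Build _ _ _ _ _ lin.
exists (HB.pack (frob_lift (h : M -> N) \o theta) F : {linear M -> N}) => z /=.
by rewrite theta_frob_act (frob_lift_tens hD hZ) scale1r; apply: hE.
Qed.

End PLinearStructure.

(** * Taylor expansion and Hasse derivatives in characteristic [p] *)

Section Taylor.
Variables (A : comNzRingType) (n : nat).
Local Notation R := {mpoly A[n]}.

(* [f(X)] goes to [f(X_1 + t, ..., X_n + t)]: the coefficients are Hasse
   derivatives, hence linear over [q]-th powers up to degree [q - 1]. *)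
Definition taylor : R -> {poly R} :=
  mmap (polyC \o @mpolyC n A) (fun i => 'X + ('X_i : R)%:P).

HB.instance Definition _ := GRing.RMorphism.on taylor.

Lemma taylor_coef0 r : (taylor r)`_0 = r.
Proof.
rewrite -horner_coef0 /taylor /mmap horner_sum [RHS]mpolyE.
apply: eq_bigr => mu _; rewrite hornerM hornerC -mul_mpolyC; congr (_ * _).
rewrite /mmap1 horner_prod mpolyXE_id; apply: eq_bigr => i _.
by rewrite horner_exp hornerD hornerX hornerC add0r.
Qed.

(** [taylor r] is [r] plus a multiple of the indeterminate, and raising to the power [p ^ e] is
    additive in characteristic [p]. *)
Lemma taylor_exp p e r : p \in [pchar A] ->
  exists Q, taylor (r ^+ (p ^ e)) = (r ^+ (p ^ e))%:P + 'X^(p ^ e) * Q.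
Proof.
move=> pA.
have qR : [pchar {poly R}].-nat (p ^ e)%N.
  rewrite pnatX (pnatE _ (pcharf_prime pA)) !inE (pcharf_prime pA) /=.
  have /andP[_ /eqP p0] := pA.
  by rewrite -polyC_natr -mpolyC_nat p0 mpolyC0 polyC0 eqxx.
exists ((\poly_(i < size (taylor r)) (taylor r)`_i.+1) ^+ (p ^ e)).
rewrite rmorphXn /= -exprMn rmorphXn -exprDn_pchar //; congr (_ ^+ _).
apply/polyP => -[|i]; rewrite coefD coefC coefXM /= ?taylor_coef0 ?addr0 //.
rewrite add0r coef_poly; case: ltnP => // h.
by rewrite nth_default // (leq_trans h).
Qed.

(** The expansion of a monomial is a product of [mdeg mu] monic linear factors, so this is its
    leading coefficient. *)
Lemma taylor_X_coef mu : (taylor 'X_[mu])`_(mdeg mu) = 1.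
Proof.
rewrite /taylor mmapX /mmap1 mdegE.
suff [/monicP] : (\prod_i ('X + ('X_i : R)%:P) ^+ mu i \is monic) /\
    size (\prod_i ('X + ('X_i : R)%:P) ^+ mu i) = (\sum_i mu i).+1.
  by move=> lc sz; rewrite -[RHS]lc lead_coefE sz.
apply: (big_ind2 (fun (P : {poly R}) d => P \is monic /\ size P = d.+1)).
- by rewrite monic1 size_poly1.
- move=> P d Q d' [mP sP] [mQ sQ]; rewrite monicMl //; split=> //.
  by rewrite size_monicM ?monic_neq0 // sP sQ addSn addnS.
- move=> i _; rewrite monic_exp ?monicXaddC //; split=> //.
  elim: (mu i) => [|k IH]; first by rewrite expr0 size_poly1.
  rewrite exprS size_monicM ?monicXaddC ?monic_neq0 ?monic_exp ?monicXaddC //.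
  by rewrite IH size_XaddC.
Qed.

End Taylor.

(** * Monomials of degree below [p ^ e] acting on [e]-fold iterates of [Phi] *)

Section Nonvanishing.
Variables (A : comNzRingType) (n p : nat) (M : lmodType {mpoly A[n]}).
Variables (theta : {linear M -> frob p M}) (theta_inv : frob p M -> M).
Hypotheses (thetaK : cancel theta theta_inv) (theta_invK : cancel theta_inv theta).
Hypothesis pA : p \in [pchar A].
Local Notation R := {mpoly A[n]}.
Local Notation Phi := (frob_act theta_inv).

Lemma pchar_mpoly : p \in [pchar R].
Proof.
have /andP[pp /eqP p0] := pA.
by rewrite inE pp -mpolyC_nat p0 mpolyC0 eqxx.
Qed.

(** By [frob_act_lift] the Hasse derivatives of order below [p ^ e] act on [M], applied to [r] in
    [r *: iter e Phi y]. The one of order [mdeg mu] sends ['X_[mu] *: iter e Phi z] to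
    [iter e Phi z]. *)
Lemma mpolyX_iter_frob_act_eq0 (e : nat) (mu : 'X_{1..n}) (z : M) :
  (mdeg mu < p ^ e)%N -> 'X_[mu] *: iter e Phi z = 0 -> iter e Phi z = 0.
Proof.
move=> lt X0.
pose q1 := (p ^ e).-1.
pose V := restr_scalars (@taylor A n) (shift_mod M succn).
(* The indeterminate moves the value at [j.+1] to [j], so its power [p ^ e] pushes a value at [q1]
   off the end. Placing the value there makes exactly the orders [0] to [p ^ e - 1] visible. *)
pose g (y : M) : V := fun j => if j == q1 then iter e Phi y else 0.
have gD : {morph g : y y' / y + y'}.
  move=> y y'; apply: funext => j; rewrite /g.
  transitivity ((if j == q1 then iter e Phi y else 0) + (if j == q1 then iter e Phi y' else 0)) => [|//].
  by case: ifP; rewrite ?addr0 // (iter_frob_actD thetaK theta_invK).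
have actE (r : R) y j : (r *: g y : V) j =
    if (j <= q1)%N then (taylor r)`_(q1 - j) *: iter e Phi y else 0.
  transitivity (shift_scale (taylor r) (g y : shift_mod M succn) j) => [//|].
  (* The range must contain [q1 - j], the only index that can contribute, even when it exceeds the
     degree of [taylor r]. *)
  pose d := maxn (size (taylor r)) (q1 - j).+1.
  have iterE k : iter k succn j = (k + j)%N by elim: k => //= k ->.
  rewrite (@shift_scale_bound _ _ _ _ d) ?leq_maxl // /g.
  under eq_bigr do rewrite iterE.
  case: leqP => jq; last first.
    by rewrite big1 // => k _; rewrite gtn_eqF ?scaler0 // ltn_addl.
  have dq : (q1 - j < d)%N by rewrite leq_max leqnn orbT.
  rewrite (bigD1 (Ordinal dq)) //= subnK // eqxx big1 ?addr0 // => k.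
  rewrite -val_eqE /= -{2}(subnK jq) eqn_add2r => /negbTE ->.
  by rewrite scaler0.
have q_gt0 : (0 < p ^ e)%N by apply: leq_ltn_trans lt.
have gZ r y : g (r *: y) = r ^+ (p ^ e) *: g y.
  apply: funext => j; rewrite actE {1}/g.
  have [Q ->] := taylor_exp e r pA.
  rewrite coefD coefC coefXnM (iter_frob_actZ thetaK theta_invK).
  case: (ltngtP j q1) => // [lt_j|->]; last by rewrite subnn q_gt0 addr0.
  by rewrite subn_eq0 leqNgt lt_j (leq_ltn_trans (leq_subr _ _)) ?addr0 ?scale0r // ltn_predL.
have [h hE] := frob_act_lift theta_invK pchar_mpoly gD gZ.
have : h ('X_[mu] *: iter e Phi z) = 0 by rewrite X0 linear0.
(* Evaluation at this index reads off the coefficient of index [mdeg mu]. *)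
rewrite linearZ /= hE => /(congr1 (fun f : V => f (q1 - mdeg mu)%N)).
have le : (mdeg mu <= q1)%N by rewrite -ltnS prednK.
by rewrite actE leq_subr subKn // taylor_X_coef scale1r.
Qed.

End Nonvanishing.

(** * Components for the bigrading and for its coarsenings *)

Section HomogeneousComponents.
Variables (A : comNzRingType) (m n : nat) (M : lmodType {mpoly A[m + n]}).
Variables (G : bigrading M) (hG : is_bigraded G).
Local Notation R := {mpoly A[m + n]}.

(** Bidegrees may repeat, so that decompositions of two elements simply concatenate. *)
Definition homog_list (l : seq ((int * int) * M)) : Prop :=
  forall q, q \in l -> G q.1 q.2.

Lemma homog_list_exists x :
  exists l, homog_list l /\ x = \sum_(q <- l) q.2.
Proof.
have [s [c cG ->]] := bigraded_span hG x.
exists [seq (d, c d) | d <- s]; split; last by rewrite big_map.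
by move=> q /mapP[d _ ->]; apply: cG.
Qed.

Section Part.
Variables (J : eqType) (kappa : int * int -> J).

(** The labelling [kappa] coarsens the grading: [id] keeps both degrees, [fst] and [snd] keep one of
    them. *)
Definition part (l : seq ((int * int) * M)) (j : J) : M :=
  \sum_(q <- l | kappa q.1 == j) q.2.

(* The sum of the components of [x] whose bidegree has label [j]. *)
Definition component (x : M) (j : J) : M :=
  part (sval (cid (homog_list_exists x))) j.

End Part.

Lemma bigradedD d x y : G d x -> G d y -> G d (x + y).
Proof.
move=> hx hy; have := bigradedB hG hx (bigradedB hG (bigraded0 hG d) hy).
by rewrite sub0r opprK.
Qed.

Lemma part_homog l d : homog_list l -> G d (part id l d).
Proof.
move=> hl; rewrite /part big_seq_cond.
apply: (big_ind (G d)) => [|x y|q /andP[ql /eqP <-]].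
- exact: bigraded0.
- exact: bigradedD.
- exact: hl.
Qed.

(** Collecting the terms of equal bidegree gives the repetition-free form that [bigraded_free]
    requires. *)
Lemma part_regroup (P : pred (int * int)) l :
  \sum_(q <- l | P q.1) q.2 =
  \sum_(d <- undup [seq q.1 | q <- l] | P d) part id l d.
Proof.
rewrite /part (exchange_big_dep (fun q => P q.1)) /=; last first.
  by move=> d q Pd /eqP ->.
rewrite big_seq_cond [RHS]big_seq_cond; apply: eq_bigr => q /andP[ql Pq].
rewrite big_mkcond (bigD1_seq q.1) /= ?undup_uniq ?mem_undup ?map_f //.
rewrite Pq eqxx big1 ?addr0 // => d ne.
by rewrite (eq_sym q.1) (negbTE ne) andbF.
Qed.

Lemma part_eq0 l : homog_list l -> \sum_(q <- l) q.2 = 0 ->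
  forall (J : eqType) (kappa : int * int -> J) j, part kappa l j = 0.
Proof.
move=> hl l0 J kappa j; rewrite /part (part_regroup (fun d => kappa d == j)).
rewrite big_seq_cond big1 // => d /andP[dl _].
rewrite (part_regroup xpredT) in l0.
apply: (bigraded_free hG (undup_uniq _) _ l0) => // d'.
exact: part_homog.
Qed.

Section Component.
Variables (J : eqType) (kappa : int * int -> J).

(** The component does not depend on the chosen decomposition: the difference of two decompositions
    is one of zero, whose parts vanish. *)
Lemma component_sum l j : homog_list l ->
  component kappa (\sum_(q <- l) q.2) j = part kappa l j.
Proof.
rewrite /component; case: cid => l' /= [hl' e] hl.
have h : homog_list (l ++ [seq (q.1, - q.2) | q <- l']).
  move=> q; rewrite mem_cat => /orP[/hl //|/mapP[q' /hl' Gq ->] /=].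
  by rewrite -sub0r; apply: (bigradedB hG) Gq; apply: bigraded0.
have h0 : \sum_(q <- l ++ [seq (q.1, - q.2) | q <- l']) q.2 = 0.
  by rewrite big_cat big_map /= sumrN -e subrr.
have /eqP := part_eq0 h h0 kappa j.
by rewrite /part big_cat big_map /= sumrN subr_eq0 => /eqP.
Qed.

Lemma componentD x y j :
  component kappa (x + y) j = component kappa x j + component kappa y j.
Proof.
have [l [hl ->]] := homog_list_exists x.
have [l' [hl' ->]] := homog_list_exists y.
have h : homog_list (l ++ l').
  by move=> q; rewrite mem_cat => /orP[/hl|/hl'].
by rewrite -big_cat !component_sum // /part big_cat.
Qed.

Lemma component_homog d x j :
  G d x -> component kappa x j = if kappa d == j then x else 0.
Proof.
move=> hx; have h : homog_list [:: (d, x)] by move=> q; rewrite inE => /eqP ->.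
have := component_sum j h; rewrite /part big_seq1 => ->.
by rewrite big_mkcond big_seq1.
Qed.

Lemma component0 j : component kappa 0 j = 0.
Proof. by rewrite (component_homog _ (bigraded0 hG 0)) if_same. Qed.

End Component.

Lemma componentZ (J : zmodType) (kappa : int * int -> J) delta r x j :
  poly_bigrading delta r -> {morph kappa : d d' / d + d'} ->
  component kappa (r *: x) j = r *: component kappa x (j - kappa delta).
Proof.
move=> hr kD; have [l [hl ->]] := homog_list_exists x.
have h : homog_list [seq (delta + q.1, r *: q.2) | q <- l].
  by move=> q /mapP[q' /hl Gq ->] /=; apply: (bigradedZ hG).
rewrite component_sum // scaler_sumr.
have := component_sum kappa j h; rewrite big_map /= => ->.
rewrite /part big_map scaler_sumr; apply: eq_bigl => q /=.
by rewrite kD [RHS]eq_sym subr_eq addrC eq_sym.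
Qed.

(** A bidegree other than [d] differs from it in some coordinate. The component of [x] for that
    coordinate vanishes, hence so does each of its bihomogeneous parts. *)
Lemma homog_of_component d x :
  (forall j, j != d.1 -> component fst x j = 0) ->
  (forall j, j != d.2 -> component snd x j = 0) -> G d x.
Proof.
have [l [hl ->]] := homog_list_exists x => h1 h2.
have part0 (kappa : int * int -> int) d' :
    component kappa (\sum_(q <- l) q.2) (kappa d') = 0 -> part id l d' = 0.
  rewrite component_sum // /part -big_filter => l0.
  have hf : homog_list [seq q <- l | kappa q.1 == kappa d'].
    by move=> q; rewrite mem_filter => /andP[_ /hl].
  rewrite -[RHS](part_eq0 hf l0 id d') /part big_filter_cond /=.
  by apply: eq_bigl => q; case: (eqVneq q.1 d') => [->|]; rewrite ?eqxx ?andbF.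
rewrite (part_regroup xpredT).
apply: (big_ind (G d)) => [|x' y|d' _]; [exact: bigraded0|exact: bigradedD|].
have [->|ne] := eqVneq d' d; first exact: part_homog.
suff -> : part id l d' = 0 by apply: bigraded0.
have [e1|ne1] := eqVneq d'.1 d.1; last exact: (part0 fst) (h1 _ ne1).
have [e2|ne2] := eqVneq d'.2 d.2; last exact: (part0 snd) (h2 _ ne2).
by case/eqP: ne; apply/eqP; rewrite -pair_eqE /= /pair_eq e1 e2 !eqxx.
Qed.

End HomogeneousComponents.

(** * Weights encoded by a torus coaction *)

Section WeightCoaction.
Variables (A : comNzRingType) (m n : nat).
Local Notation R := {mpoly A[m + n]}.
Variables (w : int * int -> int) (wt : 'I_(m + n) -> nat).
Hypothesis wE : forall mu : 'X_{1..m + n},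
  w (bideg_monom mu) = Posz (\sum_i wt i * mu i)%N.

(** The coaction of the multiplicative group given by the weights [wt]: the exponent of the
    indeterminate records the weight of a monomial. *)
Definition weight_coaction : R -> {poly R} :=
  mmap (polyC \o @mpolyC (m + n) A) (fun i => ('X_i : R)%:P * 'X^(wt i)).

HB.instance Definition _ := GRing.RMorphism.on weight_coaction.

(** A function [f] stands for the formal sum of [f j] times the [j]-th power of the indeterminate,
    with no finiteness condition. It serves as the target for the family of all components of an
    element. *)
Definition weight_mod (M : lmodType R) : lmodType R :=
  restr_scalars weight_coaction (shift_mod M (fun j : int => j - 1)).

Lemma weight_coaction_monom c mu : weight_coaction (c *: 'X_[mu]) =
  (c *: 'X_[mu])%:P * 'X^(\sum_i wt i * mu i)%N.
Proof.
rewrite /weight_coaction mmapZ mmapX /= -mul_mpolyC polyCM -mulrA.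
congr (_ * _); rewrite /mmap1 mpolyXE_id rmorph_prod /= -prodrXr -big_split /=.
by apply: eq_bigr => i _; rewrite exprMn rmorphXn -exprM.
Qed.

Lemma poly_bigrading_monom c mu :
  poly_bigrading (bideg_monom mu) (c *: 'X_[mu] : R).
Proof. by move=> nu /msuppZ_le; rewrite msuppX inE => /eqP ->. Qed.

Variable M : lmodType R.
Implicit Types f : weight_mod M.

Lemma weight_modZ delta r f j :
  poly_bigrading delta r -> (r *: f) j = r *: (f (j - w delta) : M).
Proof.
have iterE k : iter k (fun j' : int => j' - 1) j = j - Posz k.
  elim: k => [|k IH]; first by rewrite subr0.
  by rewrite iterS IH -addn1 PoszD opprD addrA.
move=> hr; rewrite [r]mpolyE !scaler_suml.
transitivity (\sum_(mu <- msupp r) ((r@_mu *: 'X_[mu] *: f) j : M)).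
  by elim/big_ind2 : _ => // [f1 x1 f2 x2 <- <-].
rewrite big_seq [RHS]big_seq; apply: eq_bigr => mu /hr <-.
transitivity (shift_scale (weight_coaction (r@_mu *: 'X_[mu]))
  (f : shift_mod M (fun j' : int => j' - 1)) j) => [//|].
by rewrite weight_coaction_monom shift_scaleCXn iterE wE.
Qed.

Lemma weight_modZ_exp k delta r f j : poly_bigrading delta r ->
  (r ^+ k *: f) j = r ^+ k *: (f (j - w delta *+ k) : M).
Proof.
move=> hr; elim: k f j => [|k IH] f j.
  by rewrite expr0 !scale1r mulr0n subr0.
rewrite exprSr -!scalerA IH (weight_modZ _ _ hr) mulrS.
by rewrite opprD addrA addrAC.
Qed.

End WeightCoaction.

(** * The map [Phi] multiplies bidegrees by [p] *)

Section FrobeniusBigraded.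
Variables (A : comNzRingType) (m n p : nat) (pA : p \in [pchar A]).
Local Notation R := {mpoly A[m + n]}.
Variables (M : lmodType R) (G : bigrading M) (hG : is_bigraded G).
Variables (theta : {linear M -> frob p M}) (theta_inv : frob p M -> M).
Hypotheses (thetaK : cancel theta theta_inv) (theta_invK : cancel theta_inv theta).
Hypothesis theta_bideg : preserves_bidegree G (frob_bigrading (p := p) G) theta.
Local Notation Phi := (frob_act theta_inv).

(** Homogeneity of [Phi z] would follow from the independence of the components of [frob p M]. The
    linear map [h] on [M] stands in for that independence: it computes weight components, and its
    values on [Phi z] are known. *)
Lemma component_frob_act (w : int * int -> int) (wt : 'I_(m + n) -> nat) :
  {morph w : d d' / d + d'} ->
  (forall mu : 'X_{1..m + n}, w (bideg_monom mu) = Posz (\sum_i wt i * mu i)%N) ->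
  forall d z j, G d z -> j != w d *+ p -> component hG w (Phi z) j = 0.
Proof.
move=> wD wE.
have p_gt0 : (0 < p)%N by rewrite prime_gt0 // (pcharf_prime pA).
have pR := pchar_mpoly (m + n) pA.
pose kappa d := w d *+ p.
have kD : {morph kappa : d d' / d + d'} by move=> d d'; rewrite /kappa wD mulrnDl.
pose V := weight_mod wt M.
(* This is the expected family of components of [Phi z]; [kappa] carries the factor [p] by which
   [Phi] should scale weights. *)
pose g (z : M) : V := fun j => Phi (component hG kappa z j).
have gD : {morph g : z z' / z + z'}.
  move=> z z'; apply: funext => j.
  by rewrite /g componentD (frob_actD thetaK theta_invK).
have gZ r z : g (r *: z) = r ^+ (p ^ 1) *: g z.
  rewrite expn1; elim/mpolyind: r => [|c mu r _ _ IH].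
    rewrite expr0n gtn_eqF // !scale0r; apply: funext => j.
    by rewrite /g component0 (frob_act0 thetaK theta_invK).
  have -> : (c *: 'X_[mu] + r) ^+ p = (c *: 'X_[mu]) ^+ p + r ^+ p.
    exact: (rmorphD (pFrobenius_aut pR)).
  rewrite !scalerDl gD IH; congr (_ + _); apply: funext => j.
  have hmu := @poly_bigrading_monom A m n c mu.
  rewrite (weight_modZ_exp wE _ _ _ hmu) /g.
  by rewrite (componentZ _ _ _ hmu kD) (frob_actZ thetaK theta_invK).
have [h hE] := frob_act_lift theta_invK pR gD gZ.
(* The induction runs over the generators of the grading, where [y] has the form [r *: Phi x] and
   [h] is explicit. *)
have h_frob d u : frob_bigrading (p := p) G d u ->
    forall y, u = theta y -> forall j, h y j = if w d == j then y else 0.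
  elim=> {d u} [d|d u u' _ IH _ IH'|d e r x hr hx] y uE j.
  - have -> : y = 0 by apply: (can_inj thetaK); rewrite -uE linear0.
    by rewrite linear0 if_same.
  - have -> : y = theta_inv u + theta_inv u'.
      by apply: (can_inj thetaK); rewrite linearD /= !theta_invK.
    transitivity (h (theta_inv u) j + h (theta_inv u') j : M); first by rewrite linearD.
    by rewrite IH ?IH' ?theta_invK //; case: ifP; rewrite ?addr0.
  - have -> : y = r *: Phi x.
      by apply: (can_inj thetaK); rewrite (theta_frob_actZ theta_invK).
    rewrite linearZ /= (hE x) (weight_modZ wE _ _ hr) /g (component_homog hG _ _ hx).
    have -> : (kappa e == j - w d) = (w (d + e *+ p) == j).
      have wM : w (e *+ p) = kappa e.
        rewrite /kappa; elim: (p) => [|k IH]; last by rewrite !mulrS wD IH.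
        by apply: (addrI (w 0)); rewrite mulr0n -wD !addr0.
      by rewrite wD wM eq_sym subr_eq eq_sym addrC.
    by case: ifP => // _; rewrite (frob_act0 thetaK theta_invK) scaler0.
(* Since [theta] preserves bidegree, [h_frob] applies to each homogeneous summand of [y]. *)
have h_comp y j : component hG w y j = h y j.
  have [l [hl ->]] := homog_list_exists hG y.
  rewrite component_sum // /part big_mkcond raddf_sum.
  transitivity (\sum_(q <- l) (h q.2 j : M)); last first.
    by elim/big_ind2 : _ => // [f1 x1 f2 x2 -> ->].
  rewrite big_seq [RHS]big_seq; apply: eq_bigr => q /hl /theta_bideg Gq.
  by rewrite (h_frob _ _ Gq).
move=> d z j hz ne; rewrite h_comp (hE z) /g (component_homog hG _ _ hz).
by rewrite eq_sym (negbTE ne) (frob_act0 thetaK theta_invK).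
Qed.

Lemma frob_act_homog d z : G d z -> G (d *+ p) (Phi z).
Proof.
move=> hz; have mulp (e : int * int) : e *+ p = (e.1 *+ p, e.2 *+ p).
  by elim: (p) => // k IH; rewrite !mulrS IH.
apply: (homog_of_component (hG := hG)) => j; rewrite mulp /=.
  (* Weight 1 on the variables x and 0 on the variables y yields the first degree; the opposite
     choice below yields the second. *)
  apply: (component_frob_act (wt := fun i => (i < m)%N)) hz => // mu.
  congr Posz; rewrite big_split_ord -[LHS]addn0 /=; congr (_ + _)%N.
    by apply: eq_bigr => i _; rewrite ltn_ord mul1n.
  by rewrite big1 // => i _; rewrite ltnNge leq_addr.
apply: (component_frob_act (wt := fun i => (m <= i)%N)) hz => // mu.
congr Posz; rewrite big_split_ord [in RHS]big1 /= => [|i _]; last first.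
  by rewrite leqNgt ltn_ord.
rewrite add0n.
by apply: eq_bigr => i _; rewrite leq_addr mul1n.
Qed.

Lemma iter_frob_act_homog e d z : G d z -> G (d *+ p ^ e) (iter e Phi z).
Proof.
move=> hz; elim: e => [|e IH]; first by rewrite expn0 mulr1n.
by rewrite iterS expnSr mulrnA; apply: frob_act_homog.
Qed.

End FrobeniusBigraded.

(** * Direct limits as unions of the images of their stages *)

Section Submodule.
Variables (R : comNzRingType) (L : lmodType R) (W : submodClosed L).

Definition submod_type := {x : L | x \in W}.
HB.instance Definition _ := SubChoice.on submod_type.
HB.instance Definition _ := [SubChoice_isSubLmodule of submod_type by <:].

End Submodule.

Section DirectLimit.
Variables (R : comNzRingType) (T : nat -> lmodType R).
Variables (t : forall e, {linear T e -> T e.+1}) (L : lmodType R).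
Variables (psi : forall e, {linear T e -> L}).
Hypothesis limL : direct_limit t psi.

Lemma direct_limit_raise e e' x : (e <= e')%N -> exists y, psi e x = psi e' y.
Proof.
move/subnK <-; elim: (e' - e)%N => [|k [y IH]]; first by exists x.
by exists (t (k + e) y); rewrite [RHS](limL.1 (k + e)%N).
Qed.

Definition limit_image : pred L := fun x => `[< exists e y, x = psi e y >].

Lemma limit_image_submod : submod_closed limit_image.
Proof.
split; first by apply/asboolP; exists 0%N, 0; rewrite linear0.
move=> a x x' /asboolP[e [y ->]] /asboolP[e' [y' ->]]; apply/asboolP.
have [z ->] := direct_limit_raise y (leq_maxl e e').
have [z' ->] := direct_limit_raise y' (leq_maxr e e').
by exists (maxn e e'), (a *: z + z'); rewrite linearP.
Qed.

(* The identity and a map with values in the union of the images agree on these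
   images, hence coincide. *)
Lemma direct_limit_surj x : exists e y, x = psi e y.
Proof.
pose F0 := GRing.isSubmodClosed.Build R L limit_image limit_image_submod.
pose W := submod_type (HB.pack limit_image F0 : submodClosed L).
have psiW e y : psi e y \in limit_image by apply/asboolP; exists e, y.
pose g0 e (y : T e) : W := exist _ (psi e y) (psiW e y).
have gL e : linear (@g0 e).
  by move=> a y y'; apply: val_inj; rewrite /= linearP.
pose F e := GRing.isLinear.Build _ _ _ _ _ (gL e).
pose g e : {linear T e -> W} := HB.pack (@g0 e) (F e).
have gE e y : g e.+1 (t e y) = g e y by apply: val_inj; apply: limL.1.
have [h [hE _]] := limL.2 _ _ gE.
have [h0 [_ h0U]] := limL.2 _ _ limL.1.
have e1 : val \o h =1 h0.
  by apply: (h0U (val \o h : {linear L -> L})) => e y /=; rewrite hE.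
have e2 : idfun =1 h0 by apply: (h0U (idfun : {linear L -> L})).
have -> : x = val (h x) by rewrite [LHS]e2 -e1.
exact/asboolP/(valP (h x)).
Qed.

End DirectLimit.

(** * Nilpotence of [Phi] on a finitely generated generator *)

Section GeneratingMorphism.
Variables (R : comNzRingType) (p : nat) (M U : lmodType R).
Variables (theta : {linear M -> frob p M}) (theta_inv : frob p M -> M).
Hypotheses (thetaK : cancel theta theta_inv) (theta_invK : cancel theta_inv theta).
Variables (b : {linear U -> frob p U}).
Variable psi : forall e, {linear frob_iter p e U -> M}.
Hypothesis limM : direct_limit (frob_iter_map b) psi.
Hypothesis theta_psi :
  forall e x, theta (psi e x) = frob_map p (psi e) (frob_iter_map b e x).
Local Notation Phi := (frob_act theta_inv).

(** Compatibility of [theta] with the limit shows that the image of each stage is spanned by [Phi]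
    of the image of the preceding one. *)
Lemma psi_tens e r y : psi e.+1 (tens p r y) = r *: Phi (psi e y).
Proof.
apply: (can_inj thetaK); rewrite (theta_frob_actZ theta_invK) theta_psi /=.
by rewrite !frob_map_tens limM.1.
Qed.

(** By [psi_tens], one application of [Phi] is traded for one step up in the system. *)
Lemma psi_iter_eq0 e e' :
  (forall y, iter e' Phi (psi e y) = 0) ->
  forall y, psi (e' + e)%N y = 0.
Proof.
elim: e' e => [|e' IH] e h y; first exact: h.
have h1 (z : frob p (frob_iter p e U)) : iter e' Phi (psi e.+1 z) = 0.
  have [s ->] := frob_sumE z.
  rewrite linear_sum /= (iter_frob_act_sum thetaK theta_invK) big1 // => q _.
  have -> : psi e.+1 (tens p q.1 q.2) = q.1 *: Phi (psi e q.2) by apply: psi_tens.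
  by rewrite (iter_frob_actZ thetaK theta_invK) -iterSr h scaler0.
by move: y; rewrite addSnnS; apply: IH.
Qed.

Lemma generating_eq0 : finitely_generated U ->
  (forall v, exists e, iter e Phi v = 0) -> forall x : M, x = 0.
Proof.
move=> [s sU] nil x.
(* Finiteness of the generating set gives one exponent for all generators. *)
have [E hE] : exists E, forall i : 'I_(size s), iter E Phi (psi 0 s`_i) = 0.
  have [f fE] := choice (fun i : 'I_(size s) => nil (psi 0 s`_i)).
  exists (\max_i f i) => i; apply: (iter_frob_act_eq0 thetaK theta_invK) (fE i).
  exact: leq_bigmax.
have psi0_nil y : iter E Phi (psi 0 y) = 0.
  have [c ->] := sU y.
  pose psi0 : {linear U -> M} := psi 0; rewrite -[psi 0 _]/(psi0 _) linear_sum.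
  rewrite (iter_frob_act_sum thetaK theta_invK) big1 // => i _.
  by rewrite linearZ /= (iter_frob_actZ thetaK theta_invK) hE scaler0.
have [e [y ->]] := direct_limit_surj limM x.
(* The stage must lie above both [e], where [x] lives, and [E], beyond which [psi] vanishes; the
   trailing zero is the starting stage in [psi_iter_eq0]. *)
have le : (e <= e + E + 0)%N by rewrite addn0 leq_addr.
have [y' ->] := direct_limit_raise limM y le.
apply: psi_iter_eq0 => z.
exact: (iter_frob_act_eq0 thetaK theta_invK (leq_addl e E)) (psi0_nil z).
Qed.

End GeneratingMorphism.

(** * Choice of the monomial and conclusion *)

Lemma bideg_monom_xy (m n : nat) (i : 'I_m) (j : 'I_n) (s t : nat) :
  bideg_monom (U_(lshift n i) *+ s + U_(rshift m j) *+ t)%MM = (Posz s, Posz t).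
Proof.
congr (Posz _, Posz _).
  rewrite (bigD1 i) //= mnmDE !mulmnE !mnm1E eqxx eq_rlshift mul1n mul0n addn0.
  rewrite big1 ?addn0 // => k ne; rewrite mnmDE !mulmnE !mnm1E eq_rlshift.
  by rewrite eq_lshift eq_sym (negbTE ne).
rewrite (bigD1 j) //= mnmDE !mulmnE !mnm1E eqxx eq_lrshift mul1n mul0n add0n.
rewrite big1 ?addn0 // => k ne; rewrite mnmDE !mulmnE !mnm1E eq_lrshift.
by rewrite eq_rshift eq_sym (negbTE ne).
Qed.

(* A nonnegative multiple is pushed beyond [K] by adding [K], a negative one
   is there already. *)
Lemma shift_degree (K q : nat) (a : int) : (K <= q)%N ->
  exists2 s : nat, (s <= K)%N & K%:Z <= `|s%:Z + a *+ q|.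
Proof.
move=> Kq; have posM c : c%:Z *+ q = (c * q)%:Z by rewrite -mulr_natr natz PoszM.
case: a => a.
  by exists K => //; rewrite posM -PoszD ger0_norm // lez_nat leq_addr.
exists 0%N => //; rewrite add0r NegzE mulNrn normrN posM ger0_norm // lez_nat.
by rewrite (leq_trans Kq) // leq_pmull.
Qed.

Theorem theoremA (m n p : nat) (hm : (1 <= m)%N) (hn : (1 <= n)%N)
  (A : comNzRingType) (hA : regular A)
  (k : fieldType) (hp : p \in [pchar k]) (iota : {rmorphism k -> A})
  (M : lmodType {mpoly A[m + n]}) (G : bigrading M)
  (theta : {linear M -> frob p M}) (hM : bigraded_F_finite G theta)
  (N : int)
  (hN : forall u v : int, N <= `|u| -> N <= `|v| ->
    forall x : M, G (u, v) x -> x = 0) :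
  forall x : M, x = 0.
Proof.
have pA : p \in [pchar A].
  have /andP[pp /eqP p0] := hp.
  by rewrite inE pp -(rmorph_nat iota) p0 rmorph0 eqxx.
have [[hG [theta_inv thetaK theta_invK] theta_bideg] [U [H [b [Ufg _ _ [_]]]]]] := hM.
move=> [psi [limM theta_psi]].
apply: (generating_eq0 thetaK theta_invK limM theta_psi Ufg) => v.
(* The exponents [s] and [t] will be at most [K], so the monomial has degree at most [K + K], which
   is below [p ^ e]. This [e] does not depend on [v]. *)
pose K := `|N|%N; pose e := (K + K)%N; exists e.
have Kp : (K + K < p ^ e)%N.
  by rewrite ltn_expl // prime_gt1 // (pcharf_prime pA).
have [l [hl ->]] := homog_list_exists hG v.
rewrite (iter_frob_act_sum thetaK theta_invK) big_seq big1 // => -[[a c] x] /hl /= hx.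
have Kq : (K <= p ^ e)%N by rewrite (leq_trans (leq_addr K K)) // ltnW.
have [s sK hs] := shift_degree a Kq; have [t tK ht] := shift_degree c Kq.
pose mu := (U_(lshift n (Ordinal hm)) *+ s + U_(rshift m (Ordinal hn)) *+ t)%MM.
apply: (mpolyX_iter_frob_act_eq0 thetaK theta_invK pA (mu := mu)).
  rewrite mdegD !mdegMn !mdeg1 !mul1n (leq_ltn_trans _ Kp) //.
  exact: leq_add.
have NK : N <= K%:Z by rewrite abszE ler_norm.
(* The product has bidegree [(s + a *+ p ^ e, t + c *+ p ^ e)], inside the region where [M]
   vanishes. *)
apply: (hN _ _ (le_trans NK hs) (le_trans NK ht)).
have := bigradedZ hG (@poly_bigrading_monom A m n 1 mu)
  (iter_frob_act_homog pA hG thetaK theta_invK theta_bideg e hx).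
rewrite scale1r bideg_monom_xy.
suff -> : (a, c) *+ p ^ e = (a *+ p ^ e, c *+ p ^ e) by [].
by elim: (p ^ e)%N => // q IH; rewrite !mulrS IH.
Qed.
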